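(* Let $(S,\cdot)$ be a semigroup and suppose that $\alpha\in S^*$ is an idempotent J-element. Then $\alpha$ is a C-element.
   Context: Nonstandard setup: sufficiently saturated framework with iterated star map; $S^*$, $S^{**}=(S^* )^*$; for $\alpha\in S^*$, $\alpha^*\in S^{**}$ and $\alpha\cdot\alpha^*\in S^{**}$ by transfer. For $\gamma\in S^{(k)*}$, $\mathcal U_\gamma=\{B\subseteq S:\gamma\in B^{(k)*}\}$; $\gamma\sim\delta$ iff $\mathcal U_\gamma=\mathcal U_\delta$. $\alpha\in S^*$ is idempotent if $\alpha\cdot\alpha^*\sim\alpha$. $\alpha$ is a J-element (resp. C-element) if every $B\in\mathcal U_\alpha$ is a J-set (resp. C-set). $\mathbb N=\{1,2,\dots\}$; $\mathcal P_f(X)$ is the set of finite subsets of $X$; $\mathbb N^{[m]}$ is the set of increasing sequences $t(1)<\dots<t(m)$ in $\mathbb N$. For $m\in\mathbb N$, $a\in S^{m+1}$, $f\in S^{\mathbb N}$, $t\in\mathbb N^{[m]}$, $x(m,a,t,f)=a(1)f(t(1))a(2)f(t(2))\cdots a(m)f(t(m))a(m+1)$. $B\subseteq S$ is a J-set if for every $F\in\mathcal P_f(S^{\mathbb N})$ there are $m$, $a\in S^{m+1}$, $t\in\mathbb N^{[m]}$ with $x(m,a,t,f)\in B$ for all $f\in F$. $B$ is a C-set if there are functions $m:\mathcal P_f(S^{\mathbb N})\to\mathbb N$, $F\mapsto a(F)\in S^{m(F)+1}$, $F\mapsto t(F)\in\mathbb N^{[m(F)]}$ such that (a) $F\subsetneq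 G$ implies $t(F)(m(F))<t(G)(1)$, and (b) for all $G_1\subsetneq\cdots\subsetneq G_n$ in $\mathcal P_f(S^{\mathbb N})$ and $g_i\in G_i$, the ordered product $\prod_{i=1}^n x(m(G_i),a(G_i),t(G_i),g_i)$ (factors in order $i=1,\dots,n$) belongs to $B$. *)

(* Defs.v *)
From HB Require Import structures.
From mathcomp Require Import all_boot.
From mathcomp Require Import boolp classical_sets functions cardinality.

Set Implicit Arguments.
Unset Strict Implicit.
Unset Printing Implicit Defensive.

Local Open Scope group_scope.
Local Open Scope classical_set_scope.

(* The many-sorted first-order language of the full structure: its sorts are
   all types, and every function, every set and every element of every sort is
   a symbol of the language.  Since [set X] is itself a sort and membership is
   a relation between [X] and [set X], quantification over subsets, functions,
   families of subsets, ... is included.  Variables are de Bruijn indices into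
   the list of the sorts of the bound variables. *)
Inductive var : seq Type -> Type -> Type :=
| VZ G X : var (X :: G) X
| VS G X Y : var G X -> var (Y :: G) X.

Inductive term (G : seq Type) : Type -> Type :=
| tVar X : var G X -> term G X
| tCst X : X -> term G X
| tApp X Y : (X -> Y) -> term G X -> term G Y
| tPair X Y : term G X -> term G Y -> term G (X * Y).

Inductive formula : seq Type -> Type :=
| fEq G X : term G X -> term G X -> formula G
| fMem G X : term G X -> set X -> formula G
| fNot G : formula G -> formula G
| fAnd G : formula G -> formula G -> formula G
| fOr G : formula G -> formula G -> formula G
| fImp G : formula G -> formula G -> formula G
| fAll G X : formula (X :: G) -> formula G
| fEx G X : formula (X :: G) -> formula G.

Record interp := Interp {
  isort :> Type -> Type;
  icst : forall X, X -> isort X;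
  ifun : forall X Y, (X -> Y) -> isort X -> isort Y;
  iset : forall X, set X -> set (isort X);
  ipair : forall X Y, isort X -> isort Y -> isort (X * Y) }.

Fixpoint env (E : interp) (G : seq Type) : Type :=
  if G is X :: G' then (E X * env E G')%type else unit.

Fixpoint lookup (E : interp) G X (v : var G X) : env E G -> E X :=
  match v with
  | VZ _ _ => fun e => e.1
  | VS _ _ _ v' => fun e => lookup v' e.2
  end.

Fixpoint eval (E : interp) G X (t : term G X) (e : env E G) : E X :=
  match t with
  | tVar _ v => lookup v e
  | tCst _ x => icst E x
  | tApp _ _ f u => ifun f (eval u e)
  | tPair _ _ u v => ipair (eval u e) (eval v e)
  end.

Fixpoint holds (E : interp) G (phi : formula G) : env E G -> Prop :=
  match phi with
  | fEq _ _ t u => fun e => eval t e = eval u e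
  | fMem _ _ t A => fun e => iset A (eval t e)
  | fNot _ p => fun e => ~ holds p e
  | fAnd _ p q => fun e => holds p e /\ holds q e
  | fOr _ p q => fun e => holds p e \/ holds q e
  | fImp _ p q => fun e => holds p e -> holds q e
  | fAll _ X p => fun e => forall x : E X, holds p (x, e)
  | fEx _ X p => fun e => exists x : E X, holds p (x, e)
  end.

Definition standard : interp :=
  @Interp id (fun _ x => x) (fun _ _ f => f) (fun _ A => A)
    (fun _ _ x y => (x, y)).

(* A star map defined on all types: [E X] is X^*, [icst E x] is x^*, [ifun f]
   is f^*, [iset A] is A^*, and [ipair] is the identification of X^* x Y^* with
   (X x Y)^*.  As the star map applies to every type, it applies to X^* as
   well, which gives X^** = E (E X), and so on. *)
Record nonstandard := Nonstandard {
  nsinterp :> interp;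
  transfer : forall phi : formula [::],
    @holds standard [::] phi tt <-> @holds nsinterp [::] phi tt }.

Section Nonstandard.
Variable E : nonstandard.

(* xi \in A, for an internal subset A of X^*, i.e. an element of (P(X))^*. *)
Definition internal_mem X (A : E (set X)) (xi : E X) : Prop :=
  iset [set p : set X * X | p.1 p.2] (ipair A xi).

(* |K|^+-saturation: families of at most |K| internal subsets of X^* with the
   finite intersection property have nonempty intersection. *)
Definition saturated (K : Type) : Prop :=
  forall (X : Type) (A : K -> E (set X)),
    (forall D : set K, finite_set D ->
       exists xi, forall k, D k -> internal_mem (A k) xi) ->
    exists xi, forall k, internal_mem (A k) xi.

Definition star_op X Y Z (op : X -> Y -> Z) (xi : E X) (eta : E Y) : E Z :=
  ifun (fun p : X * Y => op p.1 p.2) (ipair xi eta).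

(* The k-fold iterates X^{(k)*} and B^{(k)*}. *)
Fixpoint istar (k : nat) (X : Type) : Type :=
  if k is k'.+1 then istar k' (E X) else X.

Fixpoint istar_set (k : nat) (X : Type) : set X -> set (istar k X) :=
  if k is k'.+1 return set X -> set (istar k X)
  then fun B => @istar_set k' (E X) (iset B) else fun B => B.

Definition ultra (S : Type) (k : nat) (gamma : istar k S) : set (set S) :=
  [set B : set S | @istar_set k S B gamma].
Arguments ultra {S} k gamma.

Definition nsequiv (S : Type) (k l : nat)
    (gamma : istar k S) (delta : istar l S) : Prop :=
  ultra k gamma = ultra l delta.
Arguments nsequiv {S} k l gamma delta.

(* alpha^*, the star of the element alpha of the set S^*. *)
Definition star_elt S (alpha : E S) : E (E S) := icst E alpha.

(* alpha seen in S^**: the star of the inclusion s |-> s^* of S in S^* is the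
   inclusion of S^* in S^**.  It differs from [star_elt]. *)
Definition incl_elt S (alpha : E S) : E (E S) := ifun (@icst E S) alpha.

Section Semigroup.
Variable S : semigroupType.

Definition smul : E S -> E S -> E S := star_op (fun x y : S => x * y).
Definition ssmul : E (E S) -> E (E S) -> E (E S) := star_op smul.

Definition ns_idempotent (alpha : E S) : Prop :=
  nsequiv 2 1 (ssmul (incl_elt alpha) (star_elt alpha)) alpha.

End Semigroup.
End Nonstandard.

Arguments ultra {E S} k gamma.
Arguments nsequiv {E S} k l gamma delta.

Definition posnat := {n : nat | (0 < n)%N}.

Definition posnat_val (n : posnat) : nat := val n.
Coercion posnat_val : posnat >-> nat.

Definition posnat1 : posnat := exist (fun n => 0 < n)%N 1%N isT.

Definition Pf (X : Type) := {F : set X | finite_set F}.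

(* N^[m] *)
Definition incseq (m : nat) :=
  {t : m.-tuple posnat | sorted (fun i j : posnat => (i < j)%N) t}.

(* The default value is irrelevant: these are used for m > 0 only. *)
Definition tfirst m (t : incseq m) : posnat := head posnat1 (val t).
Definition tlast m (t : incseq m) : posnat := last posnat1 (val t).

Section CJ.
Variable S : semigroupType.

(* a(1) f(t(1)) a(2) f(t(2)) ... a(m) f(t(m)) a(m+1) *)
Definition xprod (m : posnat) (a : m.+1.-tuple S) (t : incseq m)
    (f : posnat -> S) : S :=
  foldl (fun y p => y * f p.1 * p.2) (thead a) (zip (val t) (behead a)).

Definition Jset (B : set S) : Prop :=
  forall F : Pf (posnat -> S),
    exists (m : posnat) (a : m.+1.-tuple S) (t : incseq m),
      forall f, sval F f -> B (xprod a t f).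

(* The ordered product h(0) h(1) ... h(n) *)
Definition oprod (n : nat) (h : 'I_n.+1 -> S) : S :=
  foldl (fun y i => y * h (lift ord0 i)) (h ord0) (enum 'I_n).

Definition Cset (B : set S) : Prop :=
  exists (m : Pf (posnat -> S) -> posnat)
         (a : forall F, (m F).+1.-tuple S)
         (t : forall F, incseq (m F)),
    (forall F G, sval F `<` sval G -> (tlast (t F) < tfirst (t G))%N) /\
    (forall (n : nat) (G : 'I_n.+1 -> Pf (posnat -> S))
            (g : 'I_n.+1 -> posnat -> S),
       (forall i j : 'I_n.+1, (i < j)%N -> sval (G i) `<` sval (G j)) ->
       (forall i : 'I_n.+1, sval (G i) (g i)) ->
       B (oprod (fun i => xprod (a (G i)) (t (G i)) (g i)))).

Variable E : nonstandard.

Definition Jelement (alpha : E S) : Prop :=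
  forall B, ultra 1 alpha B -> Jset B.

Definition Celement (alpha : E S) : Prop :=
  forall B, ultra 1 alpha B -> Cset B.

End CJ.

(* Main.v *)
(** By transfer, [alpha] generates an ultrafilter p on S, and idempotency of
    [alpha] says that p is an idempotent of the Stone-Cech compactification: if
    B is in p, then so is {x | x^-1 B in p}.  For B in p put
    B' = {x in B | x^-1 B in p}; then B' is in p, and x^-1 B' is in p for every x
    in B'.  The data of a C-set are chosen by recursion on the finite set F,
    keeping all products along chains ending in F inside B'.  There are only
    finitely many products y along chains ending in proper subsets of F, so the
    intersection of B' with all the y^-1 B' is in p, hence is a J-set; it
    provides the data for F, after shifting the functions of F so that t(F)
    starts late enough. *)

Require Import Defs.
From Stdlib Require Wf_nat.
From mathcomp Require Import all_boot finmap.
From mathcomp Require Import boolp classical_sets functions cardinality.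

Set Implicit Arguments.
Unset Strict Implicit.
Unset Printing Implicit Defensive.

Local Open Scope group_scope.
Local Open Scope classical_set_scope.

(** A value at [x] is only available once all earlier values are good. Well-founded recursion picks
    a good value if there is one and [w0] otherwise; induction then shows that the default is never
    taken. *)
Lemma wf_dependent_choice (T W : Type) (R : T -> T -> Prop)
    (Q : T -> (T -> W) -> W -> Prop) (w0 : W) :
  well_founded R ->
  (forall x v v' z, (forall y, R y x -> v y = v' y) -> Q x v z -> Q x v' z) ->
  (forall x v, (forall y, R y x -> Q y v (v y)) -> exists z, Q x v z) ->
  exists v, forall x, Q x v (v x).
Proof.
move=> Rwf Qext Qstep.
(* [Q] expects a total function, so the values known below [x] are padded with [w0]; by [Qext] the
   padding is harmless. *)
pose ext x (h : forall y, R y x -> W) y :=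
  if pselect (R y x) is left r then h y r else w0.
pose F x h := if pselect (exists z, Q x (ext x h) z) is left e
  then projT1 (cid e) else w0.
pose v := Fix Rwf (fun _ => W) F.
have vE x : v x = F x (fun y _ => v y).
  rewrite /v Fix_eq // => {}x f g fg; congr (F x _).
  by apply: functional_extensionality_dep => y;
    apply: functional_extensionality_dep => r.
have extE x y : R y x -> ext x (fun y _ => v y) y = v y.
  by move=> r; rewrite /ext; case: pselect.
exists v; apply: (well_founded_ind Rwf) => x IH.
have /Qstep[z Qz] : forall y, R y x -> Q y v (v y) by [].
rewrite vE /F; case: pselect => [e|[]]; last first.
  by exists z; apply: Qext Qz => y r; rewrite extE.
by case: cid => /= z' Qz'; apply: Qext Qz' => y r; rewrite extE.
Qed.

Section FiniteSubsets.
Variable T : Type.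

Lemma wf_Pf_proper : well_founded (fun F G : Pf T => sval F `<` sval G).
Proof.
pose card (F : Pf T) := #|` fset_set (sval F : set {classic T})|.
apply: (Wf_nat.well_founded_lt_compat _ card).
case=> [F Ffin] [G Gfin] /= [FG GF]; apply/ltP.
by apply: fproper_ltn_card; rewrite fproperE; apply/andP;
  split; [|apply/negP]; rewrite -fset_set_sub.
Qed.

(** The powerset of a finite set is finite, and [sval] is injective by proof irrelevance. *)
Lemma finite_Pf_proper (F : Pf T) :
  finite_set [set G : Pf T | sval G `<` sval F].
Proof.
have powF : finite_set [set B | B `<=` sval F].
  pose pow := fpowerset (fset_set (sval F : set {classic T})).
  have := finite_image (fun X : {fset {classic T}} => [set` X])
                       (finite_fset pow).
  apply: sub_finite_set => B /= BF.
  have Ffin := svalP F; have Bfin := sub_finite_set BF Ffin.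
  exists (fset_set (B : set {classic T})); last exact: fset_setK.
  by rewrite /= fpowersetE -fset_set_sub.
have inj : {in sval @^-1` [set B | B `<=` sval F] &,
    injective (sval : Pf T -> set T)}.
  by move=> G H _ _; exact: eq_sig_hprop.
by apply: sub_finite_set (finite_preimage inj powF) => G [].
Qed.

End FiniteSubsets.

Lemma finite_set_ubound (A : set nat) :
  finite_set A -> exists k, forall n, A n -> (n <= k)%N.
Proof.
move=> /finite_seqP[s ->]; exists (\max_(n <- s) n) => n /= ns.
by rewrite (big_rem n) //= leq_maxl.
Qed.

Section UltraFilter.
Variables (E : nonstandard) (S : Type) (alpha : E S).

Lemma ultraT : ultra 1 alpha setT.
Proof.
pose phi := fAll (fMem (tVar (@VZ [::] S)) setT).
by have /(_ alpha) : @holds E [::] phi tt by apply/transfer.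
Qed.

Lemma ultraI (B C : set S) :
  ultra 1 alpha B -> ultra 1 alpha C -> ultra 1 alpha (B `&` C).
Proof.
pose phi := fAll (fImp (fAnd (fMem (tVar (@VZ [::] S)) B) (fMem (tVar (VZ _ _)) C))
                 (fMem (tVar (VZ _ _)) (B `&` C))).
have /(_ alpha) H : @holds E [::] phi tt by apply/transfer => x [].
by move=> Ba Ca; apply: H.
Qed.

Lemma ultra_bigcap (I : Type) (D : set I) (B : I -> set S) :
  finite_set D -> (forall i, D i -> ultra 1 alpha (B i)) ->
  ultra 1 alpha (\bigcap_(i in D) B i).
Proof.
move=> Dfin; have /finite_seqP[s ->] : finite_set (D : set {classic I}) by [].
move=> Bs; rewrite (@bigcap_seq {classic I}) big_seq.
by apply: big_ind => //; [exact: ultraT | exact: ultraI].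
Qed.

End UltraFilter.

Section Idempotent.
Variables (E : nonstandard) (S : semigroupType) (alpha : E S).

Lemma ultra_translate (s : S) (B : set S) :
  ultra 1 alpha [set t | B (s * t)] <-> iset B (smul (icst E s) alpha).
Proof.
pose x := tVar (@VZ [::] S).
pose sx := tApp (fun p : S * S => p.1 * p.2) (tPair (tCst _ s) x).
pose B' := [set t | B (s * t)].
pose phi := fAll (fAnd (fImp (fMem x B') (fMem sx B)) (fImp (fMem sx B) (fMem x B'))).
have /(_ alpha)[? ?] : @holds E [::] phi tt by apply/transfer => t; split.
by split.
Qed.

(** Since [E S] is itself a sort, [ultra_translate] can be transferred again, with [s] as the
    variable and [alpha] as a constant. At [s = alpha] the term [xa] becomes the product in S^**. *)
Lemma ultra_ssmul (B : set S) :
  ultra 2 (ssmul (incl_elt alpha) (star_elt alpha)) B <->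
  ultra 1 alpha [set s | ultra 1 alpha [set t | B (s * t)]].
Proof.
pose x := tVar (@VZ [::] S).
pose xa := tApp (fun p : E S * E S => smul p.1 p.2)
  (tPair (tApp (@icst E S) x) (tCst _ alpha)).
pose C := [set s | ultra 1 alpha [set t | B (s * t)]].
pose phi := fAll (fAnd (fImp (fMem x C) (fMem xa (iset B)))
                       (fImp (fMem xa (iset B)) (fMem x C))).
have /(_ alpha)[? ?] : @holds E [::] phi tt.
  by apply/transfer => s; have [? ?] := ultra_translate s B; split.
by split.
Qed.

Hypothesis idem : ns_idempotent alpha.

Lemma ultra_idem (B : set S) :
  ultra 1 alpha B -> ultra 1 alpha [set s | ultra 1 alpha [set t | B (s * t)]].
Proof. by move=> Ba; apply/ultra_ssmul; rewrite idem. Qed.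

(** The set B' of the overview. *)
Definition ultra_core (B : set S) : set S :=
  B `&` [set s | ultra 1 alpha [set t | B (s * t)]].

Lemma ultra_core_ultra (B : set S) :
  ultra 1 alpha B -> ultra 1 alpha (ultra_core B).
Proof. by move=> Ba; apply: ultraI => //; apply: ultra_idem. Qed.

(** As s^-1 B is in the ultrafilter, so is its core, and by associativity this core is s^-1 B'. *)
Lemma ultra_core_translate (B : set S) (s : S) :
  ultra_core B s -> ultra 1 alpha [set t | ultra_core B (s * t)].
Proof.
move=> [_ sB]; have := ultra_core_ultra sB; congr (ultra 1 alpha _).
apply/seteqP; split=> t [Bst tB]; split=> //=; move: tB => /=;
  by congr (ultra 1 alpha _); apply/seteqP; split=> u /=; rewrite mulgA.
Qed.

End Idempotent.

Section Jset.
Variable S : semigroupType.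

Definition pos_shift (k : nat) (i : posnat) : posnat :=
  exist (fun n => 0 < n)%N (k + val i)%N (ltn_addl k (valP i)).

Lemma sorted_pos_shift k m (t : incseq m) :
  sorted (fun i j : posnat => (i < j)%N) (map_tuple (pos_shift k) (val t)).
Proof.
rewrite sorted_map; apply: sub_sorted (valP t) => i j.
by rewrite /relpre /posnat_val /= ltn_add2l.
Qed.

Lemma xprod_pos_shift k (m : posnat) (a : m.+1.-tuple S) (t : incseq m) f :
  xprod a (exist _ (map_tuple (pos_shift k) (val t)) (sorted_pos_shift k t)) f =
  xprod a t (f \o pos_shift k).
Proof.
by rewrite /xprod /=;
  elim: (val (val t)) (behead a) (thead a) => [|i s IH] [|b r] y /=.
Qed.

(** The J-set property is applied to the functions [f \o pos_shift k]; adding [k] to the resulting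
    indices gives back values of [f], all at places beyond [k]. *)
Lemma Jset_late (B : set S) (k : nat) (F : Pf (posnat -> S)) :
  Jset B -> exists (m : posnat) (a : m.+1.-tuple S) (t : incseq m),
    (k < tfirst t)%N /\ forall f, sval F f -> B (xprod a t f).
Proof.
case: F => F Ffin /= JB.
pose F' : Pf (posnat -> S) :=
  exist (@finite_set _) _ (finite_image (fun f : posnat -> S => f \o pos_shift k) Ffin).
have [m [a [t Ht]]] := JB F'.
exists m, a, (exist _ (map_tuple (pos_shift k) (val t)) (sorted_pos_shift k t)).
split; last by move=> f Ff; rewrite xprod_pos_shift; apply: Ht; exists f.
rewrite /tfirst /=; case: t {Ht} => -[[|i s] /= /eqP st] _.
  (* An empty [t] would have length [m > 0], so the default of [head] never occurs. *)
  by case: m st {a} => -[].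
by rewrite /posnat_val /= -[X in (X < _)%N]addn0 ltn_add2l (valP i).
Qed.

End Jset.

Lemma oprod0 (S : semigroupType) (h : 'I_1 -> S) : oprod h = h ord0.
Proof. by rewrite /oprod enum_ord0. Qed.

Lemma oprodSr (S : semigroupType) n (h : 'I_n.+2 -> S) :
  oprod h = oprod (h \o widen_ord (leqnSn n.+1)) * h ord_max.
Proof.
rewrite /oprod enum_ordSr -cats1 foldl_cat /=; congr (_ * h _).
  rewrite (_ : widen_ord _ ord0 = ord0); last exact: val_inj.
  elim: (enum 'I_n) (h ord0) => [|i s IH] y //=.
  by rewrite IH; congr (foldl _ (_ * h _) _); apply: val_inj.
exact: val_inj.
Qed.

Theorem theorem5p2p11 (E : nonstandard) (K : Type)
    (K_infinite : infinite_set [set: K]%classic)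
    (E_saturated : saturated E K)
    (S : semigroupType) (alpha : E S) :
  ns_idempotent alpha -> Jelement alpha -> Celement alpha.
Proof.
move=> idem Jalpha B Ba.
pose W := {m : posnat & (m.+1.-tuple S * incseq m)%type}.
pose xp (w : W) f := xprod (projT2 w).1 (projT2 w).2 f.
pose fst_t (w : W) : nat := tfirst (projT2 w).2.
pose lst_t (w : W) : nat := tlast (projT2 w).2.
(* Besides the data for [F], the recursion carries a finite set [z.2] containing all products along
   chains that end in [F]; the last two clauses build it up chain by chain. *)
pose Q (F : Pf (posnat -> S)) (v : Pf (posnat -> S) -> W * set S)
    (z : W * set S) :=
  [/\ forall G, sval G `<` sval F -> (lst_t (v G).1 < fst_t z.1)%N,
      finite_set z.2, z.2 `<=` ultra_core alpha B,
      forall f, sval F f -> z.2 (xp z.1 f)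
    & forall G y f, sval G `<` sval F -> (v G).2 y -> sval F f ->
        z.2 (y * xp z.1 f)].
(* The default value for the recursion comes from the J-set property for the empty family. *)
have [w0 _] : exists w : W, True.
  have F0 : Pf (posnat -> S) by exists set0; exact: finite_set0.
  by have [m [a [t _]]] := Jalpha _ Ba F0; exists (existT _ m (a, t)).
have [v Qv] : exists v, forall F, Q F v (v F).
  apply: (wf_dependent_choice (w0, set0) (@wf_Pf_proper _)).
    move=> F v v' z vv' [q1 q2 q3 q4 q5]; split=> //.
      by move=> G GF; rewrite -vv' //; exact: q1.
    by move=> G y f GF; rewrite -vv' //; exact: q5.
  move=> F v IH.
  have Ffin := svalP F.
  pose D := [set G : Pf (posnat -> S) | sval G `<` sval F].
  have Dfin : finite_set D := finite_Pf_proper F.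
  pose T := \bigcup_(G in D) (v G).2.
  have Tfin : finite_set T by apply: bigcup_finite => // G /IH[].
  have Tcore y : T y -> ultra_core alpha B y by move=> [G /IH[_ _ sub _ _]] /sub.
  have [k kD] := finite_set_ubound (finite_image (fun G => lst_t (v G).1) Dfin).
  pose C := ultra_core alpha B `&`
    \bigcap_(y in T) [set x | ultra_core alpha B (y * x)].
  have Ca : ultra 1 alpha C.
    apply: ultraI; first exact: ultra_core_ultra.
    by apply: ultra_bigcap => // y /Tcore; exact: ultra_core_translate.
  have [m [a [t [kt tC]]]] := Jset_late k F (Jalpha _ Ca).
  pose w : W := existT _ m (a, t).
  exists (w, xp w @` sval F `|` [set y * xp w f | y in T & f in sval F]).
  split=> /=.
  - by move=> G GF; apply: leq_ltn_trans kt; apply: kD; exists G.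
  - by rewrite finite_setU; split; [exact: finite_image|exact: finite_image2].
  - move=> _ [[f Ff <-]|[y Ty [f Ff <-]]]; have [? fT] := tC _ Ff => //.
    exact: fT.
  - by move=> f Ff; left; exists f.
  - by move=> G y f GF vy Ff; right; exists y; [exists G|exists f].
pose w F := (v F).1.
exists (fun F => projT1 (w F)), (fun F => (projT2 (w F)).1),
  (fun F => (projT2 (w F)).2).
split=> [F G FG|n G g Gmono Gg]; first by have [q _ _ _ _] := Qv G; exact: q.
(* Membership in the set recorded at the top of the chain is stronger than membership in [B], and it
   is what induction on the length of the chain can propagate. *)
suff : (v (G ord_max)).2 (oprod (fun i => xp (w (G i)) (g i))).
  by have [_ _ sub _ _] := Qv (G ord_max); case/sub.
elim: n G g Gmono Gg => [|n IH] G g Gmono Gg.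
  rewrite oprod0 (_ : ord_max = ord0); last exact: val_inj.
  by have [_ _ _ q _] := Qv (G ord0); apply: q.
rewrite oprodSr; have [_ _ _ _ q] := Qv (G ord_max).
(* The last clause of [Q] is used at the next-to-last set of the chain, with [y] the product of all
   factors but the last. *)
apply: (q (G (widen_ord (leqnSn n.+1) ord_max))); [exact: Gmono| |exact: Gg].
apply: (IH (G \o _) (g \o _)) => [i j ij|i]; [exact: Gmono|exact: Gg].
Qed.
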